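(* Every consistent atomic RCC8 network over $\{\mathbf{DC},\mathbf{NTPP},\mathbf{NTPP}^{-1}\}$ has a convex solution in $\mathbb{R}$.
   Context: A region in $\mathbb{R}^n$ ($n\geq 1$) is a nonempty regular closed subset $X$, i.e. $X=\mathrm{cl}(\mathrm{int}(X))$; write $i(X)$ for the interior. The eight RCC8 base relations between regions $a,b$ (jointly exhaustive and pairwise disjoint; $\subset$ denotes proper inclusion) are: $a\,\mathbf{EQ}\,b$: $a=b$; $a\,\mathbf{DC}\,b$: $a\cap b=\emptyset$; $a\,\mathbf{EC}\,b$: $a\cap b\neq\emptyset$ and $i(a)\cap i(b)=\emptyset$; $a\,\mathbf{PO}\,b$: $i(a)\cap i(b)\neq\emptyset$, $a\not\subseteq b$, $b\not\subseteq a$; $a\,\mathbf{TPP}\,b$: $a\subset b$ and $a\not\subset i(b)$; $a\,\mathbf{NTPP}\,b$: $a\subset i(b)$; and the converses $\mathbf{TPP}^{-1}$, $\mathbf{NTPP}^{-1}$ of the last two. Let $V$ be a finite set of variables. An RCC8 constraint is an expression $u\,R\,v$ with $u,v\in V$ and $R$ a nonempty set of base relations; an RCC8 network is a set of such constraints. It is atomic if for every pair of distinct variables $u,v$ it contains a constraint $u\,R\,v$ or $v\,R\,u$ with $R$ a singleton. It is a network over a set $\mathcal{R}$ of base relations if every constraint $u\,R\,v$ in it has $R\subseteq\mathcal{R}$. An $n$-dimensional solution (solution in $\mathbb{R}^n$) of a network is a map $\mathcal{S}$ from $V$ to regions of $\mathbb{R}^n$ such that for each constraint $u\,R\,v$ the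 base relation holding between $\mathcal{S}(u)$ and $\mathcal{S}(v)$ belongs to $R$. A network is consistent if it has a solution in $\mathbb{R}^n$ for some $n\geq 1$ (the regions need not be convex or connected). A solution is convex if every $\mathcal{S}(v)$ is a convex set. *)

(* Defs.v *)
From HB Require Import structures.
From mathcomp Require Export all_boot all_order all_algebra.
From mathcomp Require Export all_classical all_reals all_analysis.
Export numFieldNormedType.Exports.

Set Implicit Arguments.
Unset Strict Implicit.
Unset Printing Implicit Defensive.

Local Open Scope classical_set_scope.
Local Open Scope ring_scope.

Inductive rcc8 : Type := EQ | DC | EC | PO | TPP | NTPP | TPPi | NTPPi.

Section Regions.
Variable T : topologicalType.
Implicit Types a b X : set T.

Definition region X : Prop := X !=set0 /\ regclosed X.

Definition tpp a b : Prop := a `<` b /\ ~ a `<` b°.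

(* The inclusion in the interior is proper, so that NTPP is irreflexive even
   for the whole space, which is its own interior. *)
Definition ntpp a b : Prop := a `<` b°.

Definition rcc8_holds (r : rcc8) a b : Prop :=
  match r with
  | EQ => a = b
  | DC => a `&` b = set0
  | EC => a `&` b !=set0 /\ a° `&` b° = set0
  | PO => [/\ a° `&` b° !=set0, ~ a `<=` b & ~ b `<=` a]
  | TPP => tpp a b
  | NTPP => ntpp a b
  | TPPi => tpp b a
  | NTPPi => ntpp b a
  end.

End Regions.

Record rcc8_constraint (V : Type) := RCC8Constraint {
  lhs : V;
  rels : set rcc8;
  rhs : V;
  rels_neq0 : rels !=set0
}.

Section Networks.
Variable V : finType.

Definition rcc8_network := set (rcc8_constraint V).

Implicit Type N : rcc8_network.

Definition atomic N : Prop :=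
  forall u v : V, u != v ->
    exists2 c, N c &
      (exists r, rels c = [set r]) /\
      ((lhs c = u /\ rhs c = v) \/ (lhs c = v /\ rhs c = u)).

Definition network_over (B : set rcc8) N : Prop :=
  forall c, N c -> rels c `<=` B.

Variable R : realType.

(* The topology of 'rV[R]_n is the product topology, that is, the usual
   topology of R^n. *)
Definition solution (n : nat) N (S : V -> set 'rV[R]_n) : Prop :=
  (forall v, region (S v)) /\
  (forall c, N c ->
     exists2 r, rels c r & rcc8_holds r (S (lhs c)) (S (rhs c))).

Definition consistent N : Prop :=
  exists2 n : nat, (0 < n)%N &
    exists S : V -> set 'rV[R]_n, solution N S.

Definition convex_solution (n : nat) N (S : V -> set 'rV[R]_n) : Prop :=
  solution N S /\ forall v, convex_set (S v).

End Networks.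

(* Main.v *)
Require Import Defs.
From mathcomp Require Import lra unstable.

(** In a solution, NTPP is a strict order in which any two regions containing
    a common third one are comparable, so it is a forest order, and DC is
    incomparability.  A finite forest order is realized by nested or disjoint
    closed intervals, inserting the points from the top down: a new minimal
    point is put just left of the right end of the smallest interval that has
    to contain it, or to the right of everything if there is none. *)

Set Implicit Arguments.
Unset Strict Implicit.
Unset Printing Implicit Defensive.

Import Order.TTheory GRing.Theory Num.Theory.

Local Open Scope classical_set_scope.
Local Open Scope ring_scope.

(** * Room for a new endpoint among finitely many reals *)

Lemma seq_gap_left (R : realFieldType) (s : seq R) (t : R) :
  exists2 a, a < t & {in s, forall x, x < a \/ t <= x}.
Proof.
elim: s => [|y s [a at_ sa]]; first by exists (t - 1) => //; lra.
have [ty|yt] := leP t y.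
  by exists a => // x; rewrite inE => /predU1P[->|/sa //]; right.
exists (Num.max a ((y + t) / 2)); first by rewrite gt_max at_ /=; lra.
move=> x; rewrite inE => /predU1P[->|/sa[xa|tx]]; last by right.
  by left; rewrite lt_max; apply/orP; right; lra.
by left; rewrite lt_max xa.
Qed.

Lemma seq_upper_bound (R : realFieldType) (s : seq R) :
  exists t, {in s, forall x, x < t}.
Proof.
elim: s => [|y s [t st]]; first by exists 0.
exists (Num.max t (y + 1)) => x; rewrite inE lt_max.
by move=> /predU1P[->|/st -> //]; apply/orP; right; lra.
Qed.

(** * Representation of finite forest orders by intervals *)

Section ForestOrder.
Variables (V : finType) (lt : rel V).
Hypothesis lt_irr : irreflexive lt.
Hypothesis lt_trans : transitive lt.

(** An element of [A] with the fewest strict predecessors works: anything below it would have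
    strictly fewer. *)
Lemma finite_minimal (A : {set V}) : A != finset.set0 ->
  exists2 m, m \in A & {in A, forall w, ~~ lt w m}.
Proof.
case/set0Pn => x xA.
pose below v := #|[set u | lt u v]%SET|.
case: (@arg_minnP _ x (mem A) below xA) => m mA mP.
exists m => // w wA; apply/negP => wm.
have := mP w wA; rewrite leqNgt => /negP; apply.
apply: proper_card; apply/properP; split.
  by apply/fintype.subsetP => u; rewrite !inE => /lt_trans; apply.
by exists w; rewrite !inE ?lt_irr.
Qed.

Hypothesis lt_forest : forall u v w,
  lt u v -> lt u w -> v != w -> ~~ lt v w -> lt w v.

(** Induction on the size of [A], removing a minimal [m]. No other interval has to fit inside that
    of [m], so the latter can be as short as needed. *)
Lemma forest_intervals (R : realFieldType) (A : {set V}) :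
  exists l r : V -> R,
  [/\ {in A, forall v, l v < r v},
      {in A &, forall u v, lt u v -> l v < l u /\ r u < r v} &
      {in A &, forall u v, u != v -> ~~ lt u v -> ~~ lt v u ->
         r u < l v \/ r v < l u}].
Proof.
move: {2}#|A| (erefl #|A|) => n; elim: n A => [|n IH] A cardA.
  exists (fun=> 0), (fun=> 0).
  by move/eqP: cardA; rewrite cards_eq0 => /eqP ->; split => x; rewrite inE.
have /finite_minimal[m mA m_min] : A != finset.set0 by rewrite -cards_eq0 cardA.
have cardAm : #|A :\ m| = n by move: cardA; rewrite (cardsD1 m) mA => -[].
have [l [r [lr lr_nest lr_disj]]] := IH _ cardAm.
pose ends := map l (enum A) ++ map r (enum A).
have l_ends w : w \in A -> l w \in ends.
  by move=> wA; rewrite mem_cat map_f ?mem_enum.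
have r_ends w : w \in A -> r w \in ends.
  by move=> wA; rewrite mem_cat (map_f r) ?orbT ?mem_enum.
(* The new interval will lie strictly left of [t] and close to it, so [t] must be in the half-open
   interval from [l w] (excluded) to [r w] (included) exactly for the [w] above [m]. *)
have [t t_in t_out] : exists2 t,
    {in A :\ m, forall w, lt m w -> l w < t /\ t <= r w} &
    {in A :\ m, forall w, ~~ lt m w -> r w < t \/ t <= l w}.
  pose U := [set w in A :\ m | lt m w]%SET.
  have [U0|/finite_minimal[p]] := eqVneq U finset.set0.
    have [t tP] := seq_upper_bound ends.
    exists t => w /[dup] wAm; rewrite !inE => /andP[wm wA] mw.
      by have : w \in U; [rewrite inE wAm|rewrite U0 inE].
    by left; apply/tP/r_ends.
  rewrite inE => /andP[pAm mp] p_min; have lrp := lr _ pAm.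
  (* [p] is minimal among the elements above [m]; by the forest property all others above [m] are
     above [p], and their intervals contain that of [p]. *)
  exists (r p) => w wAm mw.
    have [->//|wp] := eqVneq w p.
    have wU : w \in U by rewrite inE wAm.
    have pw : lt p w by apply: (lt_forest mw mp wp); exact: p_min.
    by have [] := lr_nest _ _ pAm wAm pw; lra.
  have pw : ~~ lt p w by apply: contra mw => /(lt_trans mp).
  have [wp|wp] := boolP (lt w p).
    by have [_ ?] := lr_nest _ _ wAm pAm wp; left.
  have wDp : w != p by apply: contraNneq mw => ->.
  by have [?|?] := lr_disj _ _ wAm pAm wDp wp pw; [left|right]; lra.
(* No old endpoint lies between [a] (included) and [t] (excluded), so the interval from [a] to the
   midpoint of [a] and [t] meets no old endpoint. *)
have [a at_ a_gap] := seq_gap_left ends t.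
pose l' v := if v == m then a else l v.
pose r' v := if v == m then (a + t) / 2 else r v.
have l'E v : v != m -> l' v = l v by rewrite /l' => /negPf ->.
have r'E v : v != m -> r' v = r v by rewrite /r' => /negPf ->.
have l'm : l' m = a by rewrite /l' eqxx.
have r'm : r' m = (a + t) / 2 by rewrite /r' eqxx.
have disj_m w : w \in A :\ m -> ~~ lt m w -> r' w < l' m \/ r' m < l' w.
  move=> wAm mw; move: (wAm); rewrite !inE => /andP[wm wA].
  rewrite l'm r'm l'E ?r'E //.
  have lrw := lr _ wAm.
  have [rt|tl] := t_out _ wAm mw; last by right; lra.
  by left; have [] := a_gap _ (r_ends _ wA); lra.
exists l', r'; split.
- move=> v vA; have [->|vm] := eqVneq v m; first by rewrite l'm r'm; lra.
  by rewrite l'E ?r'E //; apply: lr; rewrite !inE vm.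
- move=> u v uA vA uv.
  have vm : v != m by apply: contraTneq uv => ->; exact: m_min.
  have vAm : v \in A :\ m by rewrite !inE vm.
  have [um|um] := eqVneq u m; last first.
    by rewrite !l'E // !r'E //; apply: lr_nest; rewrite // !inE um.
  rewrite um in uv *; rewrite l'm r'm l'E ?r'E //.
  have [lt_ tr] := t_in _ vAm uv.
  by have [] := a_gap _ (l_ends _ vA); lra.
- move=> u v uA vA uv nuv nvu.
  have [um|um] := eqVneq u m.
    subst u; rewrite eq_sym in uv.
    have vAm : v \in A :\ m by rewrite !inE uv.
    by have [?|?] := disj_m v vAm nuv; [right|left].
  have [vm|vm] := eqVneq v m.
    by subst v; apply: disj_m => //; rewrite !inE um.
  by rewrite !l'E // !r'E //; apply: lr_disj; rewrite // !inE ?um ?vm.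
Qed.

End ForestOrder.

(** * Closed balls of a normed space, which in dimension one are the closed intervals *)

Section ClosedBalls.
Variables (R : realType) (E : normedModType R).
Implicit Types (x y : E) (r s : R).

Lemma in_closed_ball x r z : 0 < r ->
  closed_ball x r z <-> `|x - z| <= r.
Proof. by move=> r0; rewrite closed_ballE. Qed.

Lemma region_closed_ball x r : 0 < r -> region (closed_ball x r).
Proof.
move=> r0; split; first by exists x; exact: closed_ballxx.
exact/closure_open_regclosed/ball_open.
Qed.

Lemma convex_closed_ball x r : 0 < r -> convex_set (closed_ball x r).
Proof.
move=> r0 y z k; rewrite !inE !in_closed_ball // => xy xz.
have k0 : 0 <= k%:num by [].
have k1 : 0 <= k%:num.~ by exact: onem_ge0.
rewrite [X in `|X|](_ : _ = k%:num *: (x - y) + k%:num.~ *: (x - z)).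
  rewrite (le_trans (ler_normD _ _)) // !normrZ !ger0_norm //.
  rewrite -[leRHS]mul1r -[in leRHS](add_onemK k%:num) [leRHS]mulrDl.
  by rewrite lerD // ler_wpM2l.
by rewrite !scalerBr addrACA -scalerDl add_onemK scale1r -opprD.
Qed.

Lemma closed_ball_disjoint x y r s : 0 < r -> 0 < s -> r + s < `|x - y| ->
  closed_ball x r `&` closed_ball y s = set0.
Proof.
move=> r0 s0 rs; apply/seteqP; split => // z [].
rewrite !in_closed_ball // => xz yz.
by have := ler_distD z x y; rewrite (distrC z y); lra.
Qed.

(* The unit vector provides the point that makes the inclusion proper. *)
Lemma closed_ball_ntpp (e : E) x y r s : `|e| = 1 -> 0 < r ->
  `|x - y| + r < s -> ntpp (closed_ball x r) (closed_ball y s).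
Proof.
move=> e1 r0 rs; have s0 : 0 < s by have := normr_ge0 (x - y); lra.
rewrite /ntpp interior_closed_ballE // -ball_normE; split.
  move=> z; rewrite in_closed_ball // => xz /=.
  by have := ler_distD x y z; rewrite (distrC y x); lra.
(* Any [t] strictly between [r] and [s - |x - y|] puts [x + t *: e] outside the small ball and
   inside the open large one. *)
pose t := (r + (s - `|x - y|)) / 2.
have [t_r t_s] : r < t /\ `|x - y| + t < s by rewrite /t; split; lra.
have xt : `|x - (x + t *: e)| = t.
  by rewrite opprD addNKr normrN normrZ e1 mulr1 gtr0_norm // (lt_trans r0).
move=> /(_ (x + t *: e)) sub; have /= : closed_ball x r (x + t *: e).
  apply: sub => /=; have := ler_distD x y (x + t *: e).
  by rewrite xt (distrC y x); lra.
by rewrite in_closed_ball // xt; lra.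
Qed.

End ClosedBalls.

(** * Order properties of NTPP *)

Section NTPP.
Variable T : topologicalType.
Implicit Types a b c : set T.

Lemma ntpp_irr a : ~ ntpp a a.
Proof. by move=> [_]; apply; exact: interior_subset. Qed.

Lemma ntpp_trans b a c : ntpp a b -> ntpp b c -> ntpp a c.
Proof.
move=> [ab nab] [bc _]; split.
  by move=> x /ab /interior_subset /bc.
by move=> ca; apply: nab => x /interior_subset /bc /ca.
Qed.

Lemma ntpp_not_DC a b : a !=set0 -> ntpp a b -> a `&` b != set0.
Proof.
move=> [x ax] [ab _]; apply/set0P; exists x; split=> //.
exact: interior_subset (ab _ ax).
Qed.

End NTPP.

Theorem proposition3 (R : realType) (V : finType) (N : rcc8_network V)
    (N_atomic : atomic N)
    (N_over : network_over [set DC; NTPP; NTPPi] N)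
    (N_consistent : consistent R N) :
  exists S : V -> set 'rV[R]_1, convex_solution N S.
Proof.
case: N_consistent => n _ [S [S_region S_sol]].
have S_neq0 v : S v !=set0 by case: (S_region v).
pose lt u v := `[< ntpp (S u) (S v) >].
have lt_irr : irreflexive lt by move=> u; apply/asboolPn/ntpp_irr.
have lt_trans : transitive lt.
  by move=> v u w /asboolP uv /asboolP vw; apply/asboolP/(ntpp_trans uv).
have trichotomy u v : u != v -> [\/ S u `&` S v = set0, lt u v | lt v u].
  move=> uv; have [c Nc [_ uvc]] := N_atomic _ _ uv.
  have [r cr] := S_sol _ Nc; have := N_over _ Nc _ cr.
  case: uvc => -[-> ->] [[]|] -> /= h;
    by [constructor 1; rewrite // setIC|constructor 2; apply/asboolP
       |constructor 3; apply/asboolP].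
(* Two regions that both contain the nonempty [S u] cannot be disjoint. *)
have lt_forest u v w : lt u v -> lt u w -> v != w -> ~~ lt v w -> lt w v.
  move=> /asboolP[uv _] /asboolP[uw _] vw nvw.
  have [vw0|vw1|//] := trichotomy _ _ vw; last by rewrite vw1 in nvw.
  have [x ux] := S_neq0 u; suff : (S v `&` S w) x by rewrite vw0.
  by split; apply: interior_subset; [exact: uv|exact: uw].
have [l [r [lr lr_nest lr_disj]]] :=
  forest_intervals lt_irr lt_trans lt_forest R [set: V]%SET.
have inV v : v \in [set: V]%SET by rewrite inE.
(* Normalising a nonzero vector gives a unit vector without computing any norm; multiples of [e] are
   then at the same distance as their coefficients. *)
have [e e1] : exists e : 'rV[R]_1, `|e| = 1.
  have n0 : const_mx 1 != 0 :> 'rV[R]_1.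
    by apply/eqP => /matrixP/(_ 0 0)/eqP; rewrite !mxE oner_eq0.
  exists (`|const_mx 1 : 'rV[R]_1|^-1 *: const_mx 1).
  by rewrite normrZ normfV normr_id mulVf // normr_eq0.
(* The ball of [v] is the interval from [l v] to [r v], carried to the line along [e]. *)
pose rad v := (r v - l v) / 2.
pose ctr v := ((l v + r v) / 2) *: e.
have rad_gt0 v : 0 < rad v by have := lr v (inV _); rewrite /rad; lra.
have dist u v : `|ctr u - ctr v| = `|(l u + r u) / 2 - (l v + r v) / 2|.
  by rewrite -scalerBl normrZ e1 mulr1.
pose S' v := closed_ball (ctr v) (rad v).
have S'_ntpp u v : ntpp (S u) (S v) -> ntpp (S' u) (S' v).
  move=> /asboolP uv; apply: (closed_ball_ntpp e1) => //.
  have [lvu ruv] := lr_nest u v (inV _) (inV _) uv.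
  by rewrite dist -ltrBrDr ltr_norml /rad; apply/andP; split; lra.
(* Nonempty disjoint regions are distinct and incomparable for NTPP, so their intervals are
   disjoint. *)
have S'_DC u v : S u `&` S v = set0 -> S' u `&` S' v = set0.
  move=> uv; apply: closed_ball_disjoint => //.
  have not_lt x y : S x `&` S y = set0 -> ~~ lt x y.
    by move=> xy; apply/asboolPn => /(ntpp_not_DC (S_neq0 x)); rewrite xy eqxx.
  have uDv : u != v.
    apply/eqP => uv_eq; move: uv; rewrite uv_eq setIid => Sv0.
    by have [x] := S_neq0 v; rewrite Sv0.
  have nvu : ~~ lt v u by apply: not_lt; rewrite setIC.
  have lru := lr u (inV _); have lrv := lr v (inV _).
  rewrite dist ltr_normr /rad; apply/orP.
  have [?|?] := lr_disj u v (inV _) (inV _) uDv (not_lt _ _ uv) nvu.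
    by right; lra.
  by left; lra.
exists S'; split; last by move=> v; exact: convex_closed_ball.
split=> [v|c Nc]; first exact: region_closed_ball.
(* The base relation that holds in [S] is kept, so constraints with several relations or with equal
   sides need no separate treatment. *)
have [b cb p] := S_sol _ Nc; exists b => //.
by move: p; have [[]|] := N_over _ Nc _ cb => -> /=; auto.
Qed.
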